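(* Let $p$ be an odd prime and $e \geq 2$ an integer such that $p^e \neq 9$ and $2$ is a primitive root modulo $p^e$. Suppose $\xi$ and $\zeta$ are two different primitive roots modulo $p^e$ (distinct elements of $\mathbb{Z}/(p^e)$), and set $f(x) = x - \xi$, $g(x) = x - \zeta$. Then for any $\underline{u} \in G'(f(x), p^e)$ and any $\underline{v} \in G'(g(x), p^e)$, we have $$\underline{u} \not\equiv \underline{v} \pmod{2}.$$
   Context: $\mathbb{Z}/(p^e)$ is identified with the set of integers $\{0, 1, \ldots, p^e - 1\}$. For $\xi \in \mathbb{Z}/(p^e)$, $G(x-\xi, p^e)$ is the set of all sequences $\underline{u} = (u(t))_{t \geq 0}$ over $\mathbb{Z}/(p^e)$ generated by $x - \xi$, i.e. with $u(t+1) \equiv \xi\, u(t) \pmod{p^e}$ for all $t \geq 0$, each $u(t)$ being an integer in $\{0, \ldots, p^e-1\}$. $G'(x-\xi, p^e) = \{\underline{u} \in G(x-\xi, p^e) \mid \underline{u} \not\equiv \underline{0} \pmod p\}$, where $\underline{0}$ is the all-zero sequence. Congruence of sequences is termwise: $\underline{u} \equiv \underline{v} \pmod 2$ means that the integers $u(t)$ and $v(t)$, taken as the representatives in $\{0, \ldots, p^e-1\}$, have the same parity for every $t \geq 0$; $\underline{u} \not\equiv \underline{v} \pmod 2$ is the negation, i.e. parities differ for at least one $t \ge 0$. *)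

(* Defs.v *)
From HB Require Import structures.
From mathcomp Require Import all_boot all_order all_algebra.

Set Implicit Arguments.
Unset Strict Implicit.
Unset Printing Implicit Defensive.

Import GRing.Theory.
Local Open Scope ring_scope.

(* Z/(n) is 'Z_n, which for 1 < n is the ring on {0, ..., n-1} = 'I_n; the
   integer representative of a : 'Z_n is its value under the coercion to nat. *)

(* The multiplicative order of a modulo n is totient n. The library's
   k.-primitive_root a says that k is positive and that among the exponents
   1, ..., k only k satisfies a ^+ k = 1. *)
Definition primitive_root_mod (n : nat) (a : 'Z_n) : Prop :=
  (totient n).-primitive_root a.

(* Termwise congruence of the integer representatives; d need not divide n. *)
Definition seq_cong (n d : nat) (u v : nat -> 'Z_n) : Prop :=
  forall t : nat, (u t : nat) = (v t : nat) %[mod d].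

(* u \in G(x - xi, n) *)
Definition inG (n : nat) (xi : 'Z_n) (u : nat -> 'Z_n) : Prop :=
  forall t : nat, u t.+1 = xi * u t.

(* u \in G'(x - xi, p^e) *)
Definition inG' (p e : nat) (xi : 'Z_(p ^ e)) (u : nat -> 'Z_(p ^ e)) : Prop :=
  inG xi u /\ ~ seq_cong p u (fun=> 0).

(* Main.v *)
(* Writing 2 = xi^k and lam = zeta^k reduces the theorem to: if 2^i and C lam^i have
   the same parity for all i, then C = 1 and lam = 2.
   Put n = M Q with Q = p (Q = 9 if p = 3), Q | M, and call the quotient by M of a
   representative its top digit.  Shifting i by totient M multiplies 2^i and C lam^i
   by elements 1 + M a and 1 + M b with a, b prime to p, hence rotates the top
   digits.  Comparing parities along these shifts gives an affine permutation of Z/Q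
   that preserves parity; only s |-> s and s |-> -1 - s do.  So up to a sign
   2^i and C lam^i always have the same top digit, and the signs obey
   s_(i+1) = s_i + c for a constant c.
   Now z = (-1)^s_i C lam^i runs, up to sign, over all units, and with
   mu = (-1)^c lam both z, 2^i and mu z, 2^(i+1) share their top digits, so
   (mu - 2) z lies within 2 M of 0 on the circle Z/n for every unit z.  This forces
   mu = 2; the same argument forces (-1)^s_0 C = 1, and parity removes both signs. *)

Require Import Defs.
From HB Require Import structures.
From mathcomp Require Import all_boot all_order all_algebra.
From mathcomp Require Import cyclic zify ring.

Set Implicit Arguments.
Unset Strict Implicit.
Unset Printing Implicit Defensive.

Import GRing.Theory.
Local Open Scope ring_scope.

(** * Representatives and units of Z/n *)

Lemma natr_val_Zp n (x : 'Z_n) : (x : nat)%:R = x.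
Proof. exact: natr_Zp. Qed.

Lemma ltn_val_Zp n (x : 'Z_n) : (1 < n)%N -> (x < n)%N.
Proof. by move=> n_gt1; rewrite -[X in (_ < X)%N](Zp_cast n_gt1) ltn_ord. Qed.

Lemma val_ZpD n (x y : 'Z_n) : (1 < n)%N -> (x + y)%R = ((x + y) %% n)%N :> nat.
Proof. by move=> n_gt1; exact: (congr1 (modn (x + y)%N) (Zp_cast n_gt1)). Qed.

Lemma eqr_natZp n a b : (1 < n)%N ->
  (a%:R == b%:R :> 'Z_n) = (a == b %[mod n])%N.
Proof. by move=> n_gt1; rewrite -val_eqE /= !val_Zp_nat. Qed.

Lemma val_ZpN n (x : 'Z_n) : (1 < n)%N -> x != 0 -> (- x)%R = (n - x)%N :> nat.
Proof.
move=> n_gt1 x_neq0; have x_lt := ltn_val_Zp x n_gt1.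
have x_gt0 : (0 < x)%N.
  by rewrite lt0n; apply: contra x_neq0 => /eqP x0; rewrite -[x]natr_val_Zp x0.
have <- : (n - x)%:R = - x by rewrite natrB ?pchar_Zp ?sub0r ?natr_val_Zp // ltnW.
by rewrite val_Zp_nat // modn_small; lia.
Qed.

Lemma prim_root_unit n (x : 'Z_n) k : k.-primitive_root x -> x \is a GRing.unit.
Proof.
move=> xP; rewrite -(unitrX_pos x (prim_order_gt0 xP)) (prim_expr_order xP).
exact: unitr1.
Qed.

(** The powers of x with exponents below [totient n] are distinct, and there are just that many
    units. *)
Lemma unit_prim_rootX n (x y : 'Z_n) : (1 < n)%N ->
  (totient n).-primitive_root x -> y \is a GRing.unit -> exists i, y = x ^+ i.
Proof.
move=> n_gt1 xP yU; have xU := prim_root_unit xP.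
pose f (i : 'I_(totient n)) : {unit 'Z_n} := FinRing.unit 'Z_n (unitrX i xU).
have fE i : FinRing.uval (f i) = x ^+ i by [].
have f_inj : injective f.
  move=> i j /(congr1 (@FinRing.uval _)); rewrite !fE => /eqP.
  by rewrite (eq_prim_root_expr xP) !modn_small // => /eqP /val_inj.
have cardf : (#|{: {unit 'Z_n}}| <= #|'I_(totient n)|)%N.
  have := card_units_Zp (ltnW n_gt1).
  by rewrite card_ord /units_Zp cardsT => <-.
have [g _ gK] := inj_card_bij f_inj cardf.
exists (g (FinRing.unit 'Z_n yU)).
by rewrite -fE gK.
Qed.

(** * Affine maps and parity *)

Lemma parity_affine n (k c : 'Z_n) (eps : bool) :
    (1 < n)%N -> odd n -> k \is a GRing.unit ->
    (forall s : 'Z_n, odd s = eps (+) odd (k * s + c : 'Z_n)%R) ->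
  (k = 1 /\ c = 0) \/ (k = -1 /\ c = -1).
Proof.
move=> n_gt1 n_odd kU Hodd.
have val1 : (1 : 'Z_n) = 1%N :> nat by [].
have valN1 : (-1 : 'Z_n) = n.-1 :> nat.
  by rewrite val_ZpN ?oner_neq0 // val1 subn1.
have valP (s t : 'Z_n) : (s : nat) = t -> s = t by apply: val_inj.
(* -1 is the only s such that s and s + 1 have the same parity; transported by
   the affine map, c - k is the only s such that s and s + k do. *)
have oddS (s : 'Z_n) : odd (s + 1 : 'Z_n)%R = odd s -> s = -1.
  have s_lt := ltn_val_Zp s n_gt1.
  rewrite val_ZpD // val1 addn1 => e; apply: valP; rewrite valN1.
  have [s_small|] := ltnP s.+1 n; last by lia.
  by move: e; rewrite modn_small //=; case: odd.
have oddK (s : 'Z_n) : odd (s + k : 'Z_n)%R = odd s -> s = c - k.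
  move=> e; have := oddS ((s - c) / k).
  have e1 : k * ((s - c) / k) + c = s by rewrite mulrC divrK // subrK.
  have e2 : k * ((s - c) / k + 1) + c = s + k.
    by rewrite mulrDr mulr1 addrAC e1.
  rewrite Hodd e2 [in RHS]Hodd e1 e => /(_ erefl) h.
  by rewrite -e1 h mulrN1 addrC.
have kn := ltn_val_Zp k n_gt1.
have k_gt0 : (0 < k)%N.
  rewrite lt0n; apply/eqP => k0; move: kU.
  by rewrite (_ : k = 0) ?unitr0 //; apply: valP.
have one_neq0 : (1 : 'Z_n) <> 0 by apply/eqP; exact: oner_neq0.
(* For odd k, adding k keeps the parity of s = -1 and, unless k = 1, of s = -2; for even k, that of
   s = 0 and, unless k = -1, of s = 1. Two such s would contradict [oddK]. *)
case k_odd: (odd k).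
- left; have h1 : -1 = c - k.
    apply: oddK; rewrite val_ZpD // valN1 (_ : n.-1 + k = k.-1 + n)%N; last by lia.
    by rewrite modnDr modn_small; lia.
  have [k1|k_neq1] := eqVneq (k : nat) 1%N.
    have k1' : k = 1 by apply: valP.
    by split=> //; rewrite -[c](subrK k) -h1 k1' addNr.
  have valN2 : (-1 - 1 : 'Z_n) = (n - 2)%N :> nat.
    rewrite val_ZpD // valN1 (_ : n.-1 + n.-1 = (n - 2) + n)%N; last by lia.
    by rewrite modnDr modn_small; lia.
  have h2 : -1 - 1 = c - k.
    apply: oddK; rewrite val_ZpD // valN2 (_ : n - 2 + k = (k - 2) + n)%N; last by lia.
    by rewrite modnDr modn_small; lia.
  case: one_neq0; apply: oppr_inj; apply: (addrI (-1)).
  by rewrite oppr0 addr0 h2 -h1.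
- right; have h0 : 0 = c - k by apply: oddK; rewrite add0r k_odd.
  have [kN|k_neqN] := eqVneq (k : nat) n.-1.
    have k1' : k = -1 by apply: valP; rewrite valN1.
    by split=> //; rewrite -[c](subrK k) -h0 add0r.
  case: one_neq0; rewrite h0; apply: oddK.
  by rewrite val_ZpD // val1 modn_small; lia.
Qed.

(** Since a is a unit, s = y + a j runs over Z/n; in terms of s this is [parity_affine] with k = b /
    a. *)
Lemma parity_affine_eq n (a b y z : 'Z_n) (eps : bool) :
    (1 < n)%N -> odd n -> a \is a GRing.unit -> b \is a GRing.unit ->
    (forall j : 'Z_n, odd (y + a * j : 'Z_n)%R = eps (+) odd (z + b * j : 'Z_n)%R) ->
  (b = a /\ z = y) \/ (b = - a /\ z = -1 - y).
Proof.
move=> n_gt1 n_odd aU bU Hodd.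
have kU : b / a \is a GRing.unit by rewrite unitrM bU unitrV.
case: (@parity_affine n (b / a) (z - b / a * y) eps n_gt1 n_odd kU).
- move=> s; have := Hodd ((s - y) / a); rewrite mulrC divrK // addrC subrK => ->.
  by congr (_ (+) odd (nat_of_ord _)); rewrite mulrCA; ring.
- move=> [k1 c0]; left.
  have bE : b = a by rewrite -[b](divrK aU) k1 mul1r.
  by split=> //; apply/eqP; rewrite -subr_eq0 -c0 k1 mul1r.
- move=> [k1 c0]; right.
  have bE : b = - a by rewrite -[b](divrK aU) k1 mulN1r.
  by split=> //; rewrite -c0 k1 mulN1r opprK addrK.
Qed.

(** * Top digits *)

Lemma exprD1_sq0 (R : comPzRingType) (x : R) j :
  x * x = 0 -> (1 + x) ^+ j = 1 + x *+ j.
Proof.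
move=> xx0; elim: j => [|j IHj]; first by rewrite expr0 mulr0n addr0.
by rewrite exprS IHj mulrDr mulr1 mulrDl mul1r mulrnAr xx0 mul0rn addr0 -addrA -mulrS.
Qed.

Lemma unit_val_coprime n (x : 'Z_n) : (1 < n)%N ->
  (x \is a GRing.unit) = coprime n x.
Proof. by move=> n_gt1; rewrite -{1}[x]natr_val_Zp unitZpE. Qed.

(** M is odd, so a representative has the parity of its remainder plus its quotient by M. Adding M c
    leaves the remainder alone and shifts the quotient modulo Q. *)
Lemma odd_top_digit n M Q (x : 'Z_n) c :
    (1 < n)%N -> n = (M * Q)%N -> odd n ->
  odd (x + (M * c)%:R : 'Z_n)%R = odd (x %% M) (+) odd ((x %/ M + c) %% Q).
Proof.
move=> n_gt1 nE n_odd; have [M_odd Q_odd] : odd M /\ odd Q.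
  by apply/andP; rewrite -oddM -nE.
have M_gt0 : (0 < M)%N by case: (M) M_odd.
subst n.
rewrite val_ZpD // val_Zp_nat // modnDmr.
move: (nat_of_ord x) => {}x.
set w := ((x + M * c) %% (M * Q))%N.
have wM : (w %% M = x %% M)%N.
  by rewrite /w modn_dvdm ?dvdn_mulr // addnC mulnC modnMDl.
have wQ : (w %/ M = (x %/ M + c) %% Q)%N.
  by rewrite /w [(M * Q)%N]mulnC -modn_divl addnC [(M * c)%N]mulnC divnMDl // addnC.
by rewrite {1}(divn_eq w M) oddD oddM M_odd andbT wM wQ addbC.
Qed.

(** A unit has a nonzero remainder modulo M, so n - x always borrows one from the top digit. *)
Lemma top_digit_opp n M Q (x : 'Z_n) :
    (1 < n)%N -> (1 < M)%N -> n = (M * Q)%N -> x \is a GRing.unit ->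
  ((- x)%R %/ M)%N = (Q - 1 - x %/ M)%N.
Proof.
move=> n_gt1 M_gt1 nE xU; subst n.
have x_gt0 : (0 < x %% M)%N.
  rewrite lt0n; apply/eqP => Mx; move: xU; rewrite unit_val_coprime //.
  by rewrite coprimeMl (divn_eq x M) Mx addn0 /coprime gcdnMl; case: eqP => //; lia.
have x_lt := ltn_val_Zp x n_gt1.
have x_gt : (0 < x)%N by apply: leq_trans x_gt0 _; exact: leq_mod.
rewrite val_ZpN //; last by apply: contraTneq x_gt => ->.
move: (nat_of_ord x) x_gt0 x_lt x_gt => {xU} {}x x_gt0 x_lt x_gt.
have xE := divn_eq x M.
have xM : (x %% M < M)%N by rewrite ltn_mod ltnW.
have xQ : (x %/ M < Q)%N by rewrite ltn_divLR ?(ltnW M_gt1) // mulnC.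
rewrite {1}xE (_ : _ - _ = (Q - 1 - x %/ M) * M + (M - x %% M))%N; last by nia.
by rewrite divnMDl ?(ltnW M_gt1) // (@divn_small (M - _)) ?addn0 // ltn_subrL x_gt0 ltnW.
Qed.

(** Euler's theorem modulo M yields b. If p divided b, then, as (M b)^2 = 0, raising to the power
    p^(r-1) would give 1, at an exponent below [totient n]. *)
Lemma prim_root_lift p f r n M (x : 'Z_n) :
    prime p -> (0 < r <= f)%N -> M = (p ^ f)%N -> n = (M * p ^ r)%N ->
    (totient n).-primitive_root x ->
  exists b, coprime p b /\ x ^+ totient M = 1 + (M * b)%:R.
Proof.
move=> p_pr /andP[r_gt0 r_le_f] ME nE xP.
subst n; have p_gt1 := prime_gt1 p_pr.
have f_gt0 : (0 < f)%N := leq_trans r_gt0 r_le_f.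
have M_gt1 : (1 < M)%N by rewrite ME -(expn0 p) ltn_exp2l.
have n_gt1 : (1 < M * p ^ r)%N by rewrite ME -expnD -(expn0 p) ltn_exp2l // addn_gt0 f_gt0.
 set m := totient M.
have xM : coprime x M.
  have := prim_root_unit xP; rewrite unit_val_coprime // coprime_sym.
  by apply: coprime_dvdr; rewrite dvdn_mulr.
pose b := (x ^ m %/ M)%N.
have xE : x ^+ m = 1 + (M * b)%:R.
  rewrite -{1}[x]natr_val_Zp -natrX nat1r /b; congr _%:R.
  move: (nat_of_ord x) xM => a aM.
  by rewrite {1}(divn_eq (a ^ m) M) Euler_exp_totient // modn_small // addn1 mulnC.
exists b; split=> //; rewrite prime_coprime //; apply/negP => /dvdnP[c bE].
have ME' : M = (p ^ r * p ^ (f - r))%N by rewrite ME -expnD subnKC.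
have n0 k : (M * p ^ r * k)%:R = 0 :> 'Z_(M * p ^ r).
  by rewrite natrM pchar_Zp // mul0r.
have : x ^+ (m * p ^ r.-1) = 1.
  rewrite exprM xE exprD1_sq0; last first.
    rewrite -natrM -(n0 (p ^ (f - r) * b * b)%N); congr _%:R.
    by rewrite {2}ME'; ring.
  rewrite -mulrnA -[RHS]addr0 -(n0 c); congr (1 + _%:R).
  by rewrite bE -[in RHS](prednK r_gt0) expnS; ring.
move/eqP; rewrite -(prim_order_dvd xP) /m => /dvdn_leq.
have -> : totient (M * p ^ r) = (p.-1 * p ^ (f.-1 + r))%N.
  by rewrite ME -expnD totient_pfactor ?addn_gt0 ?f_gt0 // -[in LHS](prednK f_gt0).
rewrite ME totient_pfactor // -mulnA -expnD.
have p1_gt0 : (0 < p.-1)%N by rewrite -subn1 subn_gt0.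
rewrite muln_gt0 expn_gt0 p1_gt0 (ltnW p_gt1) => /(_ isT).
by rewrite leq_pmul2l // leq_exp2l // leq_add2l leqNgt prednK // leqnn.
Qed.

(* Multiplication by powers of 1 + M a adds multiples of a * y to the top digit of
   y, so the hypothesis says that an affine map of Z/Q preserves parity. *)
Lemma digit_sign n M Q (y z : 'Z_n) a b :
    n = (M * Q)%N -> odd n -> (1 < Q)%N -> (1 < M)%N -> (Q %| M)%N ->
    coprime n a -> coprime n b -> y \is a GRing.unit -> z \is a GRing.unit ->
    (forall j, odd (y * (1 + (M * a)%:R) ^+ j : 'Z_n)%R =
               odd (z * (1 + (M * b)%:R) ^+ j : 'Z_n)%R) ->
  exists s : bool, (M * b)%:R * z = (-1) ^+ s * ((M * a)%:R * y)
    /\ (((-1) ^+ s * z)%R %/ M = y %/ M)%N.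
Proof.
move=> nE n_odd Q_gt1 M_gt1 QM na nb yU zU Hodd.
have M_gt0 := ltnW M_gt1; have Q_gt0 := ltnW Q_gt1.
have n_gt1 : (1 < n)%N by rewrite nE (leq_trans M_gt1) // leq_pmulr.
have Q_odd : odd Q by move: n_odd; rewrite nE oddM => /andP[].
have n0 k : (M * (Q * k))%N%:R = 0 :> 'Z_n by rewrite mulnA -nE natrM pchar_Zp // mul0r.
have expE c j : (1 + (M * c)%N%:R : 'Z_n) ^+ j = 1 + (M * (c * j))%N%:R.
  rewrite exprD1_sq0 -?mulrnA -?mulnA // -natrM -(n0 (M %/ Q * c * c)%N).
  by congr _%:R; rewrite -{2}(divnK QM); ring.
have mulE (x : 'Z_n) c : x * (1 + (M * c)%N%:R) = x + (M * (c * x))%N%:R.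
  by rewrite mulrDr mulr1 -{2}[x]natr_val_Zp -natrM; congr (_ + _%:R); ring.
have QU (x : 'Z_n) c : coprime n c -> x \is a GRing.unit ->
    (c * x)%N%:R \is a @GRing.unit 'Z_Q.
  move=> nc xU; rewrite unitZpE // coprimeMr.
  rewrite unit_val_coprime // in xU.
  have Qn : (Q %| n)%N by rewrite nE dvdn_mull.
  by rewrite (coprime_dvdl Qn nc) (coprime_dvdl Qn xU).
have top_lt (x : 'Z_n) : (x %/ M < Q)%N.
  by rewrite ltn_divLR // mulnC -nE ltn_val_Zp.
have digitE (x : 'Z_n) c (j : 'Z_Q) :
    (((x %/ M)%N%:R + (c * x)%N%:R * j : 'Z_Q)%R : nat) = ((x %/ M + c * j * x) %% Q)%N.
  rewrite -{1}[j]natr_val_Zp -natrM -natrD val_Zp_nat //; congr (_ %% _)%N.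
  by ring.
have lift_eq (x x' : nat) : x%:R = x'%:R :> 'Z_Q -> (M * x)%N%:R = (M * x')%N%:R :> 'Z_n.
  move/eqP; rewrite eqr_natZp // => e; apply/eqP; rewrite eqr_natZp // nE.
  by rewrite -!muln_modr (eqP e).
have [] := @parity_affine_eq Q (a * y)%N%:R (b * z)%N%:R (y %/ M)%N%:R (z %/ M)%N%:R
   (odd (y %% M)%N (+) odd (z %% M)%N) Q_gt1 Q_odd (QU _ _ na yU) (QU _ _ nb zU).
- move=> j; have := Hodd j.
  rewrite !expE !mulE !(@odd_top_digit n M Q) // -!digitE.
  by case: odd; case: odd; case: odd; case: odd.
- move=> [bz /eqP]; rewrite eqr_natZp // !modn_small // => /eqP top_eq.
  exists false; rewrite !mul1r; split=> //.
  rewrite -[z]natr_val_Zp -[y]natr_val_Zp -!natrM -!mulnA.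
  exact: lift_eq.
- move=> [bz top_eq]; exists true; rewrite !mulN1r; split.
    apply/eqP; rewrite -addr_eq0 -[z]natr_val_Zp -[y]natr_val_Zp -!natrM -natrD.
    rewrite -!mulnA -mulnDr -(n0 0%N) muln0; apply/eqP; apply: lift_eq.
    by rewrite natrD bz addNr.
  rewrite (top_digit_opp n_gt1 M_gt1 nE) //.
  (* This multiple of Q lies between 1 and 2 Q - 1, so it is Q itself. *)
  have : (z %/ M + y %/ M + 1)%N%:R == 0%:R :> 'Z_Q.
    by rewrite !natrD top_eq subrK addNr.
  rewrite eqr_natZp // mod0n => /dvdnP[k].
  move: (top_lt y) (top_lt z); move: (y %/ M)%N (z %/ M)%N => y1 z1 y1_lt z1_lt e.
  have : (k * Q < 2 * Q)%N by rewrite -e; lia.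
  by rewrite ltn_pmul2r // => k_lt; case: k e k_lt => [|[|k]]; lia.
Qed.

(** * Arcs around 0 on the circle Z/n *)

Definition near0 n A (x : 'Z_n) := exists a : int, x = a%:~R /\ (`|a| < A)%N.

Lemma intr_Zp_eq0 n (a : int) : (1 < n)%N ->
  (a%:~R == 0 :> 'Z_n) = (n %| `|a|)%N.
Proof.
move=> n_gt1; case: a => a.
  by rewrite -[0]/(0%:R) eqr_natZp // mod0n.
by rewrite NegzE mulrNz oppr_eq0 -[0]/(0%:R) eqr_natZp // mod0n abszN.
Qed.

(** If D is nonzero, some D z lies within p^e / 2 of the point opposite 0, hence outside the arc. *)
Lemma near0_half_eq0 p e n A (D : 'Z_n) :
    prime p -> odd p -> n = (p ^ e.+1)%N -> (2 * A + p ^ e <= n)%N ->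
    (forall z : 'Z_n, z \is a GRing.unit -> near0 A (D * z)) ->
  D = 0.
Proof.
move=> p_pr p_odd nE A_le Dnear; apply/eqP/negP => /negP D_neq0.
have p_gt1 := prime_gt1 p_pr.
have n_gt1 : (1 < n)%N by rewrite nE -(expn0 p) ltn_exp2l.
have D_gt0 : (0 < D)%N.
  by rewrite lt0n; apply: contra D_neq0 => /eqP D0; rewrite -[D]natr_val_Zp D0.
have [w pw DE] := pfactor_coprime p_pr D_gt0; set j := logn p D in DE.
have w_gt0 : (0 < w)%N by case: (w) DE D_gt0 => // ->.
have j_le : (j <= e)%N.
  rewrite -ltnS -(ltn_exp2l _ _ p_gt1) -nE; apply: leq_ltn_trans (ltn_val_Zp D n_gt1).
  by rewrite DE leq_pmull.
have wU : (2 * w)%:R \is a @GRing.unit 'Z_n.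
  by rewrite unitZpE // nE coprimeXl // coprimeMr pw coprimen2 p_odd.
(* With D = w p^j, take z such that 2 D z = - p^j: then n divides the odd number
   2 a + p^j, whose absolute value is less than n. *)
have [|a [aE a_lt]] := Dnear (- (2 * w)%:R^-1); first by rewrite unitrN unitrV.
have : ((a + a + (p ^ j)%N%:Z)%:~R == 0 :> 'Z_n).
  rewrite !rmorphD /= -aE -pmulrn -[in D * _](natr_val_Zp D) DE natrM.
  have := divrr wU; rewrite natrM; move: (w%:R : 'Z_n) ((p ^ j)%:R : 'Z_n) => x y.
  by move: (_^-1) => c hc; apply/eqP; rewrite -[X in _ + X]mul1r -hc; ring.
rewrite intr_Zp_eq0 // => n_dvd.
have pj_le : (p ^ j <= p ^ e)%N by rewrite leq_exp2l.
have pj_odd : odd (p ^ j) by rewrite oddX p_odd orbT.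
have := dvdn_leq _ n_dvd; lia.
Qed.

(** Let r and r' be the remainders of w and z, and d < k the carry of k y into the top digit. Modulo
    n the difference is (d M + r) - k r', and both terms lie in [0, k M). *)
Lemma near0_mul n M Q (y z w : 'Z_n) k :
    n = (M * Q)%N -> (1 < n)%N -> (0 < k)%N ->
    (z %/ M = y %/ M)%N -> (w %/ M = (k%:R * y)%R %/ M)%N ->
  near0 (k * M) (w - k%:R * z).
Proof.
move=> nE n_gt1 k_gt0 zy wky.
have M_gt0 : (0 < M)%N by case: (M) nE n_gt1 => // ->.
have kyE : (k%:R * y : 'Z_n)%R = (k * y %% n)%N :> nat.
  by rewrite -{1}[y]natr_val_Zp -natrM val_Zp_nat.
rewrite kyE in wky.
have wE := divn_eq w M; have zE := divn_eq z M.
have wM := ltn_pmod w M_gt0; have zM := ltn_pmod z M_gt0.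
have kyT : (k * y %/ M = w %/ M + Q * (k * y %/ n))%N.
  rewrite wky; move: (nat_of_ord y) => x; rewrite {1}(divn_eq (k * x) n) {2}nE.
  by rewrite (mulnC M Q) mulnA divnMDl // addnC [(_ * Q)%N]mulnC.
have yT : (k * y %/ M = k * (y %/ M) + k * (y %% M) %/ M)%N.
  by rewrite {1}(divn_eq y M) mulnDr mulnA divnMDl.
have dk : (k * (y %% M) %/ M < k)%N.
  by rewrite ltn_divLR // ltn_pmul2l // ltn_pmod.
exists (w%:Z - (k * z)%N%:Z + (n * (k * y %/ n))%N%:Z); split.
  rewrite rmorphD rmorphB /= -!pmulrn !natrM !natr_val_Zp.
  by rewrite pchar_Zp // mul0r addr0.
have nq q : (n * q = Q * q * M)%N by rewrite nE; ring.
rewrite {1}wE {1}zE zy nq.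
move: (k * y %/ n)%N (k * (y %% M) %/ M)%N dk yT kyT => q d dk -> kyT.
move: (w %/ M)%N (y %/ M)%N (w %% M)%N (z %% M)%N wM zM kyT => T t r r' wM zM kyT.
have : (k * t * M + d * M = T * M + Q * q * M)%N by rewrite -!mulnDl kyT.
have : (d * M + M <= k * M)%N by rewrite -mulSnr leq_mul2r dk orbT.
have : (k * r' < k * M)%N by rewrite ltn_pmul2l.
lia.
Qed.
Lemma near0_sign n A (x : 'Z_n) (s : bool) : near0 A ((-1) ^+ s * x) -> near0 A x.
Proof.
case: s; last by rewrite mul1r.
rewrite mulN1r => -[a [xE a_lt]]; exists (- a).
by rewrite mulrNz -xE opprK abszN.
Qed.

(** * Powers with equal parities *)

(** The lower bound on n is the room that [near0_half_eq0] needs at radius 2 M; r <= f gives Q |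
    M. *)
Lemma parity_powers p f r n M Q (C lam : 'Z_n) :
    prime p -> odd p -> (0 < r <= f)%N ->
    M = (p ^ f)%N -> Q = (p ^ r)%N -> n = (M * Q)%N ->
    (4 * M + p ^ (f + r).-1 <= n)%N ->
    (totient n).-primitive_root (2%:R : 'Z_n) -> (totient n).-primitive_root lam ->
    C \is a GRing.unit ->
    (forall i, odd (2%:R ^+ i : 'Z_n)%R = odd (C * lam ^+ i : 'Z_n)%R) ->
  C = 1 /\ lam = 2%:R.
Proof.
move=> p_pr p_odd rf ME QE nE n_big two_prim lam_prim CU Hodd.
have [r_gt0 r_le_f] := andP rf; have f_gt0 := leq_trans r_gt0 r_le_f.
have p_gt1 := prime_gt1 p_pr.
have M_gt1 : (1 < M)%N by rewrite ME -(expn0 p) ltn_exp2l.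
have Q_gt1 : (1 < Q)%N by rewrite QE -(expn0 p) ltn_exp2l.
have QM : (Q %| M)%N by rewrite QE ME dvdn_exp2l.
have npE : n = (p ^ (f + r).-1.+1)%N.
  by rewrite prednK ?addn_gt0 ?f_gt0 // nE ME QE -expnD.
have n_odd : odd n by rewrite npE oddX p_odd orbT.
have n_gt1 : (1 < n)%N by rewrite npE -(expn0 p) ltn_exp2l.
have n_gt2 : (2 < n)%N by case: (n) n_odd n_gt1 => [|[|[|]]].
have twoU := prim_root_unit two_prim; have lamU := prim_root_unit lam_prim.
have cop c : coprime p c -> coprime n c by move=> pc; rewrite npE coprimeXl.
have [a [pa twoE]] := prim_root_lift p_pr rf ME (etrans nE (congr1 _ QE)) two_prim.
have [b [pb lamE]] := prim_root_lift p_pr rf ME (etrans nE (congr1 _ QE)) lam_prim.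
pose y i : 'Z_n := 2%:R ^+ i; pose z i : 'Z_n := C * lam ^+ i.
pose A : 'Z_n := (M * a)%:R; pose B : 'Z_n := (M * b)%:R.
have yU i : y i \is a GRing.unit by rewrite unitrX.
have zU i : z i \is a GRing.unit by rewrite unitrM CU unitrX.
pose sgn i (s : bool) := B * z i = (-1) ^+ s * (A * y i)
  /\ (((-1) ^+ s * z i)%R %/ M = y i %/ M)%N.
have sgnP i : exists s, sgn i s.
  apply: (digit_sign nE n_odd Q_gt1 M_gt1 QM (cop _ pa) (cop _ pb) (yU i) (zU i)) => j.
  by rewrite -twoE -lamE -!exprM -mulrA -!exprD Hodd.
(* The first clause of [sgn] fixes the sign: two signs would give 2 A w = 0, hence Q | a, although p
   does not divide a. *)
have AU_inj (w : 'Z_n) (s s' : bool) : w \is a GRing.unit ->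
    (-1) ^+ s * (A * w) = (-1) ^+ s' * (A * w) -> s = s'.
  move=> wU e; apply/eqP; rewrite -[_ == _]negbK -addbN; apply/negP => ss'.
  have : (A * w) *+ 2 = 0.
    case: s s' e ss' => [] [] // e _; rewrite mulr2n.
      by move: e; rewrite mulN1r mul1r => {1}<-; rewrite addNr.
    by move: e; rewrite mulN1r mul1r => {1}->; rewrite addNr.
  move/eqP; rewrite -mulr_natr -mulrA -(mul0r (w * 2%:R)).
  rewrite (inj_eq (mulIr _)); last by rewrite unitrM wU.
  rewrite -[0]/(0%:R) eqr_natZp // mod0n nE -/(dvdn _ _) dvdn_pmul2l ?(ltnW M_gt1) //.
  rewrite QE -(prednK r_gt0) expnS => /(dvdn_trans (dvdn_mulr _ (dvdnn p))) pda.
  by move: pa; rewrite prime_coprime // pda.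
have [s0 [B0 top0]] := sgnP 0%N; have [s1 [B1 _]] := sgnP 1%N.
(* The indices 0 and 1 already determine [A * lam] as 2 A up to the sign c, and this product governs
   the sign change at every later index. *)
pose c := s0 (+) s1.
have Alam : A * lam = (-1) ^+ c * (A * 2%:R).
  have B0' : B * C = (-1) ^+ s0 * A by move: B0; rewrite /z /y !expr0 !mulr1.
  have B1' : B * (C * lam) = (-1) ^+ s1 * (A * 2%:R) by move: B1; rewrite /z /y !expr1.
  by rewrite signr_addb -mulrA -B1' [B * _]mulrA B0' -mulrA signrMK.
have ySE i : y i.+1 = 2%:R * y i by rewrite /y exprS.
have zSE i : z i.+1 = lam * z i by rewrite /z exprSr mulrA mulrC.
have sgnS i s : sgn i s -> sgn i.+1 (s (+) c).
  move=> [Bi _]; have [s' Ss'] := sgnP i.+1.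
  rewrite (_ : s (+) c = s') //; apply: (AU_inj (y i.+1)) => //.
  case: Ss' => <- _; rewrite zSE ySE signr_addb [RHS]mulrCA Bi.
  have -> : lam * ((-1) ^+ s * (A * y i)) = (-1) ^+ s * y i * (A * lam).
    by move: ((-1) ^+ s) => d; ring.
  by rewrite Alam; move: ((-1) ^+ s) ((-1) ^+ c) => d d'; ring.
pose mu := (-1) ^+ c * lam.
have muE i s : (-1) ^+ (s (+) c) * z i.+1 = mu * ((-1) ^+ s * z i).
  by rewrite signr_addb zSE /mu; move: ((-1) ^+ s) ((-1) ^+ c) => d d'; ring.
have mu2 : mu = 2%:R.
  apply/eqP; rewrite -subr_eq0; apply/eqP.
  apply: (near0_half_eq0 p_pr p_odd npE (A := 2 * M)); first by rewrite mulnA; exact: n_big.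
  move=> w wU.
  have [i wE] : exists i, w = z i.
    have [|i iE] := @unit_prim_rootX n lam (C^-1 * w) n_gt1 lam_prim.
      by rewrite unitrM unitrV CU.
    by exists i; rewrite /z -iE mulVKr.
  have [s Ss] := sgnP i; have [_ tops] := Ss; have [_ topS] := sgnS _ _ Ss.
  rewrite muE ySE in topS.
  have := near0_mul nE n_gt1 (isT : 0 < 2)%N tops topS.
  rewrite -mulrBl mulrCA -wE; exact: near0_sign.
(* With mu = 2 the signed z i double at each step, exactly as y i does. *)
have z_top i : exists2 s, sgn i s & (-1) ^+ s * z i = (-1) ^+ s0 * C * y i.
  elim: i => [|i [s Ss zE]].
    by exists s0; [split | rewrite /z /y !expr0 !mulr1].
  exists (s (+) c); first exact: sgnS.
  by rewrite muE mu2 zE ySE mulrCA.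
have C_sign : (-1) ^+ s0 * C = 1.
  apply/eqP; rewrite -subr_eq0; apply/eqP.
  apply: (near0_half_eq0 p_pr p_odd npE (A := M)); first by apply: leq_trans n_big; rewrite leq_add2r leq_mul2r orbT.
  move=> w /(unit_prim_rootX n_gt1 two_prim)[i wE].
  have [s [_ tops] zE] := z_top i; rewrite zE in tops.
  have := near0_mul (k := 1) (y := y i) (z := y i) nE n_gt1 isT erefl.
  move=> /(_ ((-1) ^+ s0 * C * y i)); rewrite mul1r mul1n => /(_ tops).
  by rewrite -{2}[y i]mul1r -mulrBl /y -wE.
(* As n is odd, negation flips the parity of a nonzero representative. Index 0 then excludes C = -1,
   and index 1 excludes lam = -2. *)
have odd_opp (k : nat) : (0 < k < n)%N -> odd (- k%:R : 'Z_n)%R = ~~ odd k.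
  move=> /andP[k_gt0 k_lt]; rewrite val_ZpN //; last first.
    by rewrite -[0]/(0%:R) eqr_natZp // mod0n modn_small // -lt0n.
  by rewrite val_Zp_nat // modn_small // oddB ?n_odd // ltnW.
have C1 : C = 1.
  have := Hodd 0%N; rewrite !expr0 mulr1; move: C_sign.
  case: (s0); last by rewrite mul1r.
  rewrite mulN1r => C_sign; rewrite -[C]opprK C_sign.
  by rewrite -[1]/(1%:R) odd_opp ?n_gt1 // val_Zp_nat // modn_small.
split=> //; have := Hodd 1%N; rewrite !expr1 C1 mul1r; move: mu2; rewrite /mu.
case: (c); last by rewrite mul1r.
rewrite mulN1r => lam2; rewrite -[lam]opprK lam2.
by rewrite odd_opp ?n_gt2 // val_Zp_nat // modn_small.
Qed.

(* For n = 27 the choice Q = 3 separates too little and Q = 9 does not divide M = 3. *)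
Lemma parity_powers27 (C lam : 'Z_27) :
    (forall i, odd (2%:R ^+ i : 'Z_27)%R = odd (C * lam ^+ i : 'Z_27)%R) ->
  C = 1 /\ lam = 2%:R.
Proof.
(* Among all 27^2 pairs only (1, 2) shows the parities of 2^0, ..., 2^7; this is checked by
   computation, on natural numbers. *)
pose step (l c : nat) := (c * l %% 27)%N.
pose par l c := map odd (traject (step l) c 8).
move=> Hodd.
have iterE (l c : 'Z_27) i : iter i (step l) c = (c * l ^+ i)%R :> nat.
  by elim: i => [|i IHi]; rewrite ?expr0 ?mulr1 // exprSr mulrA iterS IHi.
have map_odd_traject f g k : forall x y,
    (forall i, odd (iter i f x) = odd (iter i g y)) ->
    map odd (traject f x k) = map odd (traject g y k).
  elim: k => [|k IHk] x y xy //=; rewrite (xy 0%N) (IHk _ (g y)) // => i.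
  by rewrite -!iterSr.
have parE : par lam C = par 2%N 1%N.
  apply: map_odd_traject => i.
  by rewrite iterE (iterE 2%:R 1) mul1r -Hodd.
have : all (fun c => all (fun l =>
    (par l c == par 2 1) ==> (c == 1) && (l == 2)) (iota 0 27)) (iota 0 27).
  by vm_compute.
move/allP/(_ C); rewrite mem_iota ltn_ord => /(_ isT).
move/allP/(_ lam); rewrite mem_iota ltn_ord => /(_ isT).
rewrite parE eqxx /= => /andP[/eqP C1 /eqP l2].
by split; apply: val_inj.
Qed.

(** * From sequences to powers *)

Lemma inGX n (xi : 'Z_n) u : inG xi u -> forall i t, u (t + i)%N = xi ^+ i * u t.
Proof.
move=> uG; elim=> [|i IHi] t; first by rewrite addn0 expr0 mul1r.
by rewrite addnS uG IHi exprS mulrA.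
Qed.

(** All terms are unit multiples of the first, so they are all units or all divisible by p; G'
    excludes the latter. *)
Lemma inG'_unit p e (xi : 'Z_(p ^ e)) u t : prime p -> (0 < e)%N ->
  xi \is a GRing.unit -> inG' xi u -> u t \is a GRing.unit.
Proof.
move=> p_pr e_gt0 xiU [uG u_n0]; apply: contraT => utU; case: u_n0 => i.
have n_gt1 : (1 < p ^ e)%N by rewrite -(expn0 p) ltn_exp2l ?prime_gt1.
have uE j : (u j \is a GRing.unit) = (u 0%N \is a GRing.unit).
  by rewrite -[j]add0n (inGX uG) unitrM unitrX.
move: utU; rewrite uE -(uE i) unit_val_coprime // coprime_pexpl // prime_coprime //.
by rewrite negbK mod0n => /eqP.
Qed.

Lemma parity_powers_prime p e (C lam : 'Z_(p ^ e)) :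
    prime p -> odd p -> (2 <= e)%N -> (p ^ e)%N <> 9%N ->
    (totient (p ^ e)).-primitive_root (2%:R : 'Z_(p ^ e)) ->
    (totient (p ^ e)).-primitive_root lam -> C \is a GRing.unit ->
    (forall i, odd (2%:R ^+ i : 'Z_(p ^ e))%R = odd (C * lam ^+ i : 'Z_(p ^ e))%R) ->
  C = 1 /\ lam = 2%:R.
Proof.
move=> p_pr p_odd e_ge2 pe_neq9 two_prim lam_prim CU Hodd.
have p_gt1 := prime_gt1 p_pr.
(* With Q = p the size condition of [parity_powers] reads 5 p^(e-1) <= p^e. *)
have [p_ge5|p_lt5] := leqP 5 p.
  have eE : e = (e.-1 + 1)%N by lia.
  apply: (@parity_powers p e.-1 1 (p ^ e) (p ^ e.-1) p) => //; first by lia.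
    by rewrite -expnSr prednK // ltnW.
  have eE' : (p ^ e = p * p ^ e.-1)%N by rewrite -expnS prednK // ltnW.
  by rewrite eE' -eE -mulSnr leq_mul2r p_ge5 orbT.
have p3 : p = 3%N by case: p p_odd p_gt1 p_lt5 {p_pr C lam pe_neq9 two_prim lam_prim CU Hodd} => [|[|[|[|[|]]]]].
(* With Q = 9 it reads 7 3^(e-2) <= 3^e, but r <= f now asks for e >= 4. As 9 is excluded, only 27
   is left. *)
subst p; have [e_ge4|e_lt4] := leqP 4 e.
  have eE : e = (e - 2 + 2)%N by lia.
  apply: (@parity_powers 3 (e - 2) 2 (3 ^ e) (3 ^ (e - 2)) 9) => //; first by lia.
    by rewrite {1}eE expnD.
  rewrite {3}eE expnD (_ : (e - 2 + 2).-1 = (e - 2).+1); last by lia.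
  by rewrite expnS; lia.
have e3 : e = 3%N.
  by case: e e_ge2 e_lt4 pe_neq9 {C lam two_prim lam_prim CU Hodd} => [|[|[|[|]]]].
subst e; exact: parity_powers27.
Qed.

Theorem theorem1 (p e : nat) (p_prime : prime p) (p_odd : odd p)
    (e_ge2 : (2 <= e)%N) (pe_neq9 : (p ^ e)%N <> 9%N)
    (root2 : primitive_root_mod (2 : 'Z_(p ^ e)))
    (xi zeta : 'Z_(p ^ e))
    (root_xi : primitive_root_mod xi) (root_zeta : primitive_root_mod zeta)
    (xi_neq_zeta : xi <> zeta)
    (u v : nat -> 'Z_(p ^ e))
    (uG' : inG' xi u) (vG' : inG' zeta v) :
  ~ seq_cong 2 u v.
Proof.
move=> uv2; have e_gt0 := ltnW e_ge2.
have n_gt1 : (1 < p ^ e)%N by rewrite -(expn0 p) ltn_exp2l ?prime_gt1.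
have [xiU zetaU] := (prim_root_unit root_xi, prim_root_unit root_zeta).
have uU t : u t \is a GRing.unit by exact: inG'_unit uG'.
have vU t : v t \is a GRing.unit by exact: inG'_unit vG'.
have [uX vX] := (inGX uG'.1, inGX vG'.1).
have odd_uv t : odd (u t) = odd (v t).
  by have := uv2 t; rewrite !modn2; case: odd; case: odd.
have [k xi_k] := unit_prim_rootX n_gt1 root_xi (prim_root_unit root2).
have k_coprime : coprime k (totient (p ^ e)).
  by rewrite -(prim_root_exp_coprime k root_xi) -xi_k.
have lam_prim : (totient (p ^ e)).-primitive_root (zeta ^+ k).
  by rewrite (prim_root_exp_coprime k root_zeta).
have uv t : u t = v t.
  (* Since 2^i is the inverse of u t, advancing by k i steps brings u to 1. Every k-th term from
     there on is 2^j for u and C lam^j for v, with lam = zeta^k. *)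
  have [i iE] := unit_prim_rootX n_gt1 root2 (etrans (unitrV _) (uU t)).
  have u1 : u (t + k * i)%N = 1 by rewrite uX exprM -xi_k -iE mulVr.
  have [v1 lam2] : v (t + k * i)%N = 1 /\ zeta ^+ k = 2%:R.
    apply: parity_powers_prime => // j.
    have := odd_uv (t + k * i + k * j)%N.
    by rewrite uX u1 mulr1 vX !exprM -xi_k mulrC.
  (* As lam = 2, xi and zeta have the same power with exponent k i, so equality at t + k i pulls
     back to t. *)
  apply: (mulrI (unitrX (k * i) xiU)); rewrite -uX u1 -v1 vX.
  by rewrite !exprM lam2 -xi_k.
(* Equal sequences give xi u(0) = u(1) = v(1) = zeta u(0), and u(0) is a unit. *)
case: xi_neq_zeta; apply: (mulIr (uU 0%N)).
by rewrite -(uG'.1 0%N) uv (vG'.1 0%N) uv.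
Qed.
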